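(* Let $\mathbb I=[t_0,t_f]\subset\mathbb R$ be a compact interval and consider the linear time-varying system $$E\dot x=[(J-R)Q-EK]x+(B-P)u,\qquad y=(B+P)^TQx+(S+N)u,$$ with $E,Q\in C^1(\mathbb I,\mathbb R^{n,n})$, $J,R,K\in C^0(\mathbb I,\mathbb R^{n,n})$, $B,P\in C^0(\mathbb I,\mathbb R^{n,m})$, and $S=S^T,\ N=-N^T\in C^0(\mathbb I,\mathbb R^{m,m})$. Assume that for all $t\in\mathbb I$ $$Q^TE=E^TQ\quad\text{and}\quad \frac{d}{dt}(Q^TE)=Q^T[EK-JQ]+[EK-JQ]^TQ .$$ Set $\mathcal H(x)=\frac12x^TQ^TEx$ and $$W=\begin{bmatrix} Q^TRQ & Q^TP \\ P^TQ & S \end{bmatrix}.$$ Then every classical solution $x$ (with input $u$ and output $y$) satisfies on $\mathbb I$ $$\frac{d}{dt}\mathcal H(x)=u^Ty-\begin{bmatrix} x \\ u \end{bmatrix}^T W \begin{bmatrix} x \\ u \end{bmatrix}.$$ Furthermore: i) If $W\equiv0$, then $\frac{d}{dt}\mathcal H(x)=u^Ty$. ii) If $W(t)\ge0$ for all $t\in\mathbb I$, then the dissipation inequality $$\mathcal H(x(t_1))-\mathcal H(x(t_0))\le\int_{t_0}^{t_1}y(t)^Tu(t)\,dt$$ holds for all $t_1\in\mathbb I$, $t_1\ge t_0$.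
   Context: $C^j(\mathbb I,\mathcal X)$ denotes the $j$-times continuously differentiable functions from $\mathbb I$ to $\mathcal X$, and $\mathbb R^{n,m}$ the real $n\times m$ matrices. The time argument $t$ is suppressed; $\mathcal H(x)$ along a trajectory means $t\mapsto\frac12x(t)^TQ(t)^TE(t)x(t)$. $E$ and $Q$ may be singular. A classical solution for an input $u\in C^0(\mathbb I,\mathbb R^m)$ is an $x\in C^1(\mathbb I,\mathbb R^n)$ satisfying the state equation for all $t\in\mathbb I$; $y$ is then defined by the output equation. $W(t)\ge0$ means that $W(t)$ is symmetric positive semidefinite. *)

(* Defs.v *)
From HB Require Import structures.
From mathcomp Require Import all_boot all_order all_algebra.
From mathcomp Require Import all_classical all_reals all_analysis.
Set Implicit Arguments.
Unset Strict Implicit.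
Unset Printing Implicit Defensive.
Import Order.TTheory GRing.Theory Num.Theory.
Import numFieldNormedType.Exports.
Local Open Scope classical_set_scope.
Local Open Scope ring_scope.

(* Functions on an interval I are represented by total functions F -> V; only
   their values on I matter.  The differential quotient is taken over points of
   I only, so that this is the usual derivative at interior points of I and the
   one-sided derivative at the endpoints. *)
Definition has_deriv_in (F : realType) (V : normedModType F) (I : set F)
    (f : F -> V) (t : F) (d : V) : Prop :=
  (s - t)^-1 *: (f s - f t) @[s --> within I t^'] --> d.

Definition C0_on (F : realType) (V : normedModType F) (I : set F)
    (f : F -> V) : Prop := {within I, continuous f}.

Definition C1_on_with (F : realType) (V : normedModType F) (I : set F)
    (f df : F -> V) : Prop :=
  (forall t, I t -> has_deriv_in I f t (df t)) /\ C0_on I df.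

Definition C1_on (F : realType) (V : normedModType F) (I : set F)
    (f : F -> V) : Prop := exists df, C1_on_with I f df.

(* The (0, 0) entry extracts the scalar from a 1 x 1 matrix. *)
Definition dotp (F : realType) (k : nat) (v w : 'cV[F]_k) : F :=
  (v^T *m w) 0 0.

Definition quad (F : realType) (k : nat) (M : 'M[F]_k) (z : 'cV[F]_k) : F :=
  (z^T *m M *m z) 0 0.

Definition psdmx (F : realType) (k : nat) (M : 'M[F]_k) : Prop :=
  M^T = M /\ forall z : 'cV[F]_k, 0 <= quad M z.

Definition hamiltonian (F : realType) (n : nat) (Q E : F -> 'M[F]_n)
    (x : F -> 'cV[F]_n) (t : F) : F :=
  2^-1 * quad ((Q t)^T *m E t) (x t).

Definition Wmx (F : realType) (n m : nat) (Q R : F -> 'M[F]_n)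
    (P : F -> 'M[F]_(n, m)) (S : F -> 'M[F]_m) (t : F) : 'M[F]_(n + m) :=
  block_mx ((Q t)^T *m R t *m Q t) ((Q t)^T *m P t)
           ((P t)^T *m Q t)        (S t).

Definition classical_solution (F : realType) (n m : nat) (I : set F)
    (E Q J R K : F -> 'M[F]_n) (B P : F -> 'M[F]_(n, m))
    (u : F -> 'cV[F]_m) (x : F -> 'cV[F]_n) : Prop :=
  exists2 dx : F -> 'cV[F]_n, C1_on_with I x dx &
    forall t, I t ->
      E t *m dx t = ((J t - R t) *m Q t - E t *m K t) *m x t
                    + (B t - P t) *m u t.

Definition output_eq (F : realType) (n m : nat) (I : set F)
    (Q : F -> 'M[F]_n) (B P : F -> 'M[F]_(n, m)) (S N : F -> 'M[F]_m)
    (u : F -> 'cV[F]_m) (x : F -> 'cV[F]_n) (y : F -> 'cV[F]_m) : Prop :=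
  forall t, I t ->
    y t = (B t + P t)^T *m Q t *m x t + (S t + N t) *m u t.

(* Main.v *)
(** The identity [Q^T E = E^T Q] makes [d/dt H] equal to
    [x^T Q^T E x' + 1/2 x^T (Q^T E)' x], and the hypothesis on [(Q^T E)']
    turns the second summand into [x^T Q^T (E K - J Q) x]. Substituting the
    state equation cancels [J] and [K]; skew-symmetry removes [u^T N u].
    The dissipation inequality is the fundamental theorem of calculus applied
    to this derivative, whose integrand is at most [u^T y] when [W >= 0]. *)
Require Import Defs.
From HB Require Import structures.
From mathcomp Require Import all_boot all_order all_algebra.
From mathcomp Require Import all_classical all_reals all_analysis.
From mathcomp Require Import ring lra.
Import Order.TTheory GRing.Theory Num.Theory.
Import numFieldNormedType.Exports.
Local Open Scope classical_set_scope.
Local Open Scope ring_scope.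

Set Implicit Arguments.
Unset Strict Implicit.
Unset Printing Implicit Defensive.

(** * Derivatives and continuity relative to a set *)

Lemma has_deriv_in_cvg (F : realType) (V : normedModType F) (I : set F)
    (f : F -> V) (t : F) (d : V) :
  has_deriv_in I f t d -> f s @[s --> within I t^'] --> f t.
Proof.
move=> fd.
(* The quotient tends to [d] and its factor [s - t] to 0, so this form of [f] has limit [f t]. *)
have -> : f = fun s => f t + (s - t) *: ((s - t)^-1 *: (f s - f t)).
  apply/funext => s; have [->|st] := eqVneq s t.
    by rewrite subrr scale0r addr0.
  by rewrite scalerA divff ?subr_eq0// scale1r addrC subrK.
rewrite [X in _ --> X](_ : _ = f t + (t - t) *: d); last first.
  by rewrite !subrr !scale0r.
apply: cvgD; first exact: cvg_cst.
apply: cvgZ; last exact: fd.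
apply: cvgB; last exact: cvg_cst.
by apply: cvg_trans; [exact: cvg_within|exact: cvg_within].
Qed.

Lemma C0_on_deriv (F : realType) (V : normedModType F) (I : set F)
    (f df : F -> V) :
  (forall t, I t -> has_deriv_in I f t (df t)) -> C0_on I f.
Proof.
move=> fd; apply/subspace_continuousP => t It U Uft.
have Uf : U (f t) by exact: nbhs_singleton Uft.
have /= : nbhs t [set s | s != t -> I s -> U (f s)].
  exact: has_deriv_in_cvg (fd t It) U Uft.
(* With both [within] filters unfolded to neighbourhoods of [t], they differ only at [s = t], which
   [Uf] covers. *)
change (nbhs t [set s | s != t -> I s -> U (f s)] ->
  nbhs t [set s | I s -> U (f s)]).
apply: filterS => s /= + Is.
by have [->|st] := eqVneq s t; [move=> _; exact: Uf|apply].
Qed.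

(** * Entrywise calculus of matrix-valued functions *)

Section mx_calculus.
Context {F : realType} (I : set F).

(* Entrywise derivatives and continuity spare the converse of
   [coord_continuous], from entries back to matrices. *)
Definition mx_deriv p q (A : F -> 'M[F]_(p, q)) t (D : 'M[F]_(p, q)) :=
  forall i j, has_deriv_in I (fun s => A s i j : F^o) t (D i j).

Definition mx_C0 p q (A : F -> 'M[F]_(p, q)) :=
  forall i j, C0_on I (fun s => A s i j : F^o).

(** Taking an entry is linear, hence commutes with the difference quotient, and continuous, hence
    passes to the limit. *)
Lemma has_deriv_in_mx p q (A : F -> 'M[F]_(p, q)) t D :
  has_deriv_in I A t D -> mx_deriv A t D.
Proof.
move=> AD i j; rewrite /has_deriv_in.
have -> : (fun s => (s - t)^-1 *: (A s i j - A t i j : F^o)) =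
    (fun M : 'M[F]_(p, q) => M i j) \o (fun s => (s - t)^-1 *: (A s - A t)).
  by apply/funext => s; rewrite /= !mxE.
exact: (cvg_comp _ _ AD (@coord_continuous F p q i j D)).
Qed.

Lemma C0_on_mx p q (A : F -> 'M[F]_(p, q)) : C0_on I A -> mx_C0 A.
Proof.
move=> cA i j t; exact: (cvg_comp _ _ (cA t) (@coord_continuous F p q i j _)).
Qed.

Lemma mx_deriv_tr p q (A : F -> 'M[F]_(p, q)) t D :
  mx_deriv A t D -> mx_deriv (fun s => (A s)^T) t D^T.
Proof.
by move=> AD i j; rewrite mxE; under eq_fun do rewrite mxE; exact: AD.
Qed.

Lemma has_deriv_inM (f g : F -> F^o) t (df dg : F^o) :
  has_deriv_in I f t df -> has_deriv_in I g t dg ->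
  has_deriv_in I (fun s => f s * g s : F^o) t (df * g t + f t * dg).
Proof.
move=> fd gd; rewrite /has_deriv_in.
under eq_fun => s.
  (* In the first summand [g s] still varies; its limit [g t] comes from the differentiability of
     [g]. *)
  rewrite (_ : _ *: _ = (s - t)^-1 *: (f s - f t) * g s
    + f t * ((s - t)^-1 *: (g s - g t))); last first.
    by rewrite /GRing.scale/=; ring.
  over.
apply: cvgD; first by apply: cvgM; [exact: fd|exact: has_deriv_in_cvg gd].
by apply: cvgM; [exact: cvg_cst|exact: gd].
Qed.

Lemma has_deriv_inZ (k : F) (f : F -> F^o) t (df : F^o) :
  has_deriv_in I f t df -> has_deriv_in I (fun s => k * f s : F^o) t (k * df).
Proof.
move=> fd; rewrite /has_deriv_in.
under eq_fun do rewrite -mulrBr [_ *: _]mulrCA.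
by apply: cvgM; [exact: cvg_cst|exact: fd].
Qed.

Lemma has_deriv_in_sum k (f : 'I_k -> F -> F^o) t (df : 'I_k -> F^o) :
  (forall i, has_deriv_in I (f i) t (df i)) ->
  has_deriv_in I (fun s => \sum_i f i s : F^o) t (\sum_i df i).
Proof.
move=> fd; rewrite /has_deriv_in.
under eq_fun do rewrite -sumrB scaler_sumr.
by apply: cvg_big => [|i _]; [exact: add_continuous|exact: fd].
Qed.

Lemma mx_deriv_mul p q r (A : F -> 'M[F]_(p, q)) (B : F -> 'M[F]_(q, r)) t
    DA DB :
  mx_deriv A t DA -> mx_deriv B t DB ->
  mx_deriv (fun s => A s *m B s) t (DA *m B t + A t *m DB).
Proof.
move=> dA dB i j; rewrite !mxE -big_split/=.
under eq_fun do rewrite mxE.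
by apply: has_deriv_in_sum => k; exact: has_deriv_inM.
Qed.

Lemma mx_C0_tr p q (A : F -> 'M[F]_(p, q)) :
  mx_C0 A -> mx_C0 (fun s => (A s)^T).
Proof. by move=> cA i j; under eq_fun do rewrite mxE; exact: cA. Qed.

Lemma mx_C0D p q (A B : F -> 'M[F]_(p, q)) :
  mx_C0 A -> mx_C0 B -> mx_C0 (fun s => A s + B s).
Proof.
move=> cA cB i j; under eq_fun do rewrite mxE.
by move=> t; apply: cvgD; [exact: cA|exact: cB].
Qed.

Lemma mx_C0_mul p q r (A : F -> 'M[F]_(p, q)) (B : F -> 'M[F]_(q, r)) :
  mx_C0 A -> mx_C0 B -> mx_C0 (fun s => A s *m B s).
Proof.
move=> cA cB i j; under eq_fun do rewrite mxE.
move=> t; apply: cvg_big => [|k _]; first exact: add_continuous.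
by apply: cvgM; [exact: cA|exact: cB].
Qed.

Lemma mx_C0_col p q r (A : F -> 'M[F]_(p, r)) (B : F -> 'M[F]_(q, r)) :
  mx_C0 A -> mx_C0 B -> mx_C0 (fun s => col_mx (A s) (B s)).
Proof.
move=> cA cB i j; under eq_fun do rewrite mxE.
by case: (fintype.split i) => k; [exact: cA|exact: cB].
Qed.

Lemma mx_C0_row p q r (A : F -> 'M[F]_(r, p)) (B : F -> 'M[F]_(r, q)) :
  mx_C0 A -> mx_C0 B -> mx_C0 (fun s => row_mx (A s) (B s)).
Proof.
move=> cA cB i j; under eq_fun do rewrite mxE.
by case: (fintype.split j) => k; [exact: cA|exact: cB].
Qed.

Lemma mx_C0_eq p q (A B : F -> 'M[F]_(p, q)) :
  {in I, A =1 B} -> mx_C0 A -> mx_C0 B.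
Proof.
move=> AB cA i j; apply: subspace_eq_continuous (cA i j) => t It.
exact: (congr1 (fun M : 'M[F]_(p, q) => M i j) (AB t It)).
Qed.

End mx_calculus.

(** * The fundamental theorem of calculus for relative derivatives *)

Lemma has_deriv_in_derive (F : realType) (I : set F) (f : F -> F^o) t
    (d : F^o) :
  nbhs t I -> has_deriv_in I f t d -> derivable f t 1 /\ derive1 f t = d.
Proof.
move=> It fd.
have fd0 : h^-1 *: ((f \o shift t) (h *: (1 : F^o)) - f t) @[h --> 0^'] --> d.
  move=> U Ud.
  have /= U1 : nbhs t [set s | s != t -> I s -> U ((s - t)^-1 *: (f s - f t))].
    exact: fd U Ud.
  (* Near [t] every point lies in [I], so the restriction disappears; the substitution [s = h + t]
     then gives the usual quotient. *)
  have /= U2 : nbhs t [set s | s != t -> U ((s - t)^-1 *: (f s - f t))].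
    by apply: filterS2 It U1 => s Is /[swap] st; apply.
  have ht : h + t @[h --> (0 : F^o)] --> (t : F^o).
    rewrite -[X in _ --> X]add0r; apply: cvgD; [exact: cvg_id|exact: cvg_cst].
  have := ht _ U2.
  change (nbhs (0 : F) [set h | h + t != t ->
      U ((h + t - t)^-1 *: (f (h + t) - f t))] ->
    nbhs (0 : F) [set h | h != 0 ->
      U (h^-1 *: ((f \o shift t) (h *: (1 : F^o)) - f t))]).
  apply: filterS => h /= Uh h0; move: Uh; rewrite addrK -subr_eq0 addrK.
  by move=> /(_ h0); rewrite /GRing.scale/= mulr1.
split; first by apply/cvg_ex; exists d.
by rewrite derive1E; apply/cvg_lim => //; exact: fd0.
Qed.

(** Relative differentiability on the closed interval yields ordinary derivatives inside and,
    through [C0_on_deriv], one-sided continuity of [f] at both ends, as [continuous_FTC2]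
    requires. *)
Lemma FTC2_in (F : realType) (a b : F) (f g : F -> F^o) :
  a < b -> C0_on `[a, b] g ->
  (forall t, `[a, b]%classic t -> has_deriv_in `[a, b] f t (g t)) ->
  \int[lebesgue_measure]_(t in `[a, b]) g t = f b - f a.
Proof.
move=> ab cg fg.
have dfg t : t \in `]a, b[ -> derivable f t 1 /\ derive1 f t = g t.
  move=> tab; apply: (@has_deriv_in_derive _ `[a, b]); last first.
    by apply: fg; exact: subset_itv_oo_cc.
  by apply: filterS (near_in_itvoo tab); exact: subset_itv_oo_cc.
rewrite /Rintegral (@continuous_FTC2 _ g f)//; last first.
  by move=> t /dfg[].
have /continuous_within_itvP-/(_ ab)[_ fa fb] := C0_on_deriv fg.
by split=> // t /dfg[].
Qed.

(** * Scalar products, quadratic forms and the power balance at a fixed time *)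

Section dotp_quad.
Context {F : realType}.

Lemma dotpC k (v w : 'cV[F]_k) : dotp v w = dotp w v.
Proof. by rewrite /dotp -[v^T *m w]trmxK trmx_mul trmxK mxE. Qed.

Lemma dotp_tr k l (M : 'M[F]_(k, l)) v w : dotp v (M *m w) = dotp (M^T *m v) w.
Proof. by rewrite /dotp trmx_mul trmxK mulmxA. Qed.

Lemma dotpDr k (u v w : 'cV[F]_k) : dotp u (v + w) = dotp u v + dotp u w.
Proof. by rewrite /dotp mulmxDr mxE. Qed.

Lemma dotp0 k (v : 'cV[F]_k) : dotp v 0 = 0.
Proof. by rewrite /dotp mulmx0 mxE. Qed.

Lemma dotpNr k (u v : 'cV[F]_k) : dotp u (- v) = - dotp u v.
Proof. by rewrite /dotp mulmxN mxE. Qed.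

Lemma quadE k (M : 'M[F]_k) z : quad M z = dotp z (M *m z).
Proof. by rewrite /quad /dotp mulmxA. Qed.

Lemma dotp_skew k (N : 'M[F]_k) v : N = - N^T -> dotp v (N *m v) = 0.
Proof.
move=> Nskew; have : dotp v (N *m v) = - dotp v (N *m v).
  by rewrite {1}Nskew mulNmx dotpNr dotpC -dotp_tr.
by lra.
Qed.

Lemma quad_Wmx n m (Q R : F -> 'M[F]_n) (P : F -> 'M[F]_(n, m))
    (S : F -> 'M[F]_m) t x u :
  quad (Wmx Q R P S t) (col_mx x u) =
  dotp x ((Q t)^T *m R t *m Q t *m x) + dotp x ((Q t)^T *m P t *m u)
  + (dotp u ((P t)^T *m Q t *m x) + dotp u (S t *m u)).
Proof.
rewrite quadE /Wmx mul_block_col /dotp tr_col_mx mul_row_col !mulmxDr !mxE.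
by [].
Qed.

End dotp_quad.

(** Pure algebra at one time [t]. The left side keeps the exact shape that the product rule gives
    for half of [(x^T (Q^T E)) x], with the prescribed derivative of [Q^T E] inserted. *)
Lemma power_balance (F : realType) n m (E Q J R K : F -> 'M[F]_n)
    (B P : F -> 'M[F]_(n, m)) (S N : F -> 'M[F]_m) t
    (u y : 'cV[F]_m) (x dx : 'cV[F]_n) :
  (Q t)^T *m E t = (E t)^T *m Q t -> N t = - (N t)^T ->
  E t *m dx = ((J t - R t) *m Q t - E t *m K t) *m x + (B t - P t) *m u ->
  y = (B t + P t)^T *m Q t *m x + (S t + N t) *m u ->
  let L := E t *m K t - J t *m Q t in
  2^-1 * (((dx^T *m ((Q t)^T *m E t) + x^T *m ((Q t)^T *m L + L^T *m Q t)) *m x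
           + x^T *m ((Q t)^T *m E t) *m dx) 0 0)
  = dotp u y - quad (Wmx Q R P S t) (col_mx x u).
Proof.
move=> QE Nskew state -> L; rewrite quad_Wmx.
set M := (Q t)^T *m E t.
have Msym : M^T = M by rewrite /M trmx_mul trmxK QE.
have Lsym : L^T *m Q t = ((Q t)^T *m L)^T by rewrite trmx_mul trmxK.
(* The two terms in [dx] agree because [M] is symmetric, the two in [L] because they are transposes
   of each other; the resulting 2 cancels the factor one half. *)
have -> : ((dx^T *m M + x^T *m ((Q t)^T *m L + L^T *m Q t)) *m x
    + x^T *m M *m dx) 0 0
  = 2 * (dotp x (M *m dx) + dotp x ((Q t)^T *m L *m x)).
  have -> : ((dx^T *m M + x^T *m ((Q t)^T *m L + L^T *m Q t)) *m x
      + x^T *m M *m dx) 0 0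
    = dotp dx (M *m x) + (dotp x ((Q t)^T *m L *m x)
        + dotp x (((Q t)^T *m L)^T *m x)) + dotp x (M *m dx).
    by rewrite Lsym mulmxDr !mulmxDl /dotp !mulmxA !mxE.
  rewrite (dotp_tr M) Msym (dotpC (M *m dx)) (dotp_tr (_^T)) trmxK.
  by rewrite (dotpC ((Q t)^T *m L *m x)); ring.
rewrite mulrA mulVf ?pnatr_eq0// mul1r -dotpDr -!mulmxA -mulmxDr.
have -> : E t *m dx + L *m x = - (R t *m (Q t *m x)) + (B t *m u - P t *m u).
  rewrite mulmxA state /L !mulmxBl.
  (* Once the products are generalized to arbitrary vectors, what remains is a linear identity
     checked entrywise. *)
  move: (_ *m x) (_ *m x) (_ *m x) (_ *m u) (_ *m u).
  by move=> a b c d e; apply/matrixP => i j; rewrite !mxE; ring.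
rewrite [(B t + P t)^T]linearD/=.
rewrite !(mulmxDl, mulmxDr, mulmxN, dotpDr, dotpNr) (dotp_skew _ Nskew).
(* Only the [B] terms still differ in form: one comes from the state equation, the other from the
   output. *)
have -> : dotp u ((B t)^T *m (Q t *m x)) = dotp x ((Q t)^T *m (B t *m u)).
  by rewrite dotp_tr trmxK dotp_tr dotpC.
ring.
Qed.

(** Serves to restrict the balance from [[t0, tf]] to [[t0, t1]] before integrating. *)
Lemma has_deriv_in_subset (F : realType) (V : normedModType F) (I I' : set F)
    (f : F -> V) t d :
  I `<=` I' -> has_deriv_in I' f t d -> has_deriv_in I f t d.
Proof.
by move=> II' fd; apply: cvg_trans fd; apply: cvg_app; exact: within_subset.
Qed.

(** * Power balance along solutions and the dissipation inequality *)

Theorem theorem11 (F : realType) (n m : nat) (t0 tf : F) (ht0f : t0 < tf)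
  (E Q J R K : F -> 'M[F]_n) (B P : F -> 'M[F]_(n, m)) (S N : F -> 'M[F]_m)
  (hE : C1_on `[t0, tf] E) (hQ : C1_on `[t0, tf] Q)
  (hJ : C0_on `[t0, tf] J) (hR : C0_on `[t0, tf] R) (hK : C0_on `[t0, tf] K)
  (hB : C0_on `[t0, tf] B) (hP : C0_on `[t0, tf] P)
  (hS : C0_on `[t0, tf] S) (hN : C0_on `[t0, tf] N)
  (hSsym : forall t, t \in `[t0, tf] -> S t = (S t)^T)
  (hNskew : forall t, t \in `[t0, tf] -> N t = - (N t)^T)
  (hQE : forall t, t \in `[t0, tf] -> (Q t)^T *m E t = (E t)^T *m Q t)
  (hdQE : forall t, t \in `[t0, tf] ->
    has_deriv_in `[t0, tf] (fun s => (Q s)^T *m E s) t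
      ((Q t)^T *m (E t *m K t - J t *m Q t)
       + (E t *m K t - J t *m Q t)^T *m Q t)) :
  forall (u : F -> 'cV[F]_m) (x : F -> 'cV[F]_n) (y : F -> 'cV[F]_m),
    C0_on `[t0, tf] u ->
    classical_solution `[t0, tf] E Q J R K B P u x ->
    output_eq `[t0, tf] Q B P S N u x y ->
  [/\ forall t, t \in `[t0, tf] ->
        has_deriv_in `[t0, tf] (hamiltonian Q E x) t
          (dotp (u t) (y t) - quad (Wmx Q R P S t) (col_mx (x t) (u t))),
      (forall t, t \in `[t0, tf] -> Wmx Q R P S t = 0) ->
        forall t, t \in `[t0, tf] ->
          has_deriv_in `[t0, tf] (hamiltonian Q E x) t (dotp (u t) (y t))
    & (forall t, t \in `[t0, tf] -> psdmx (Wmx Q R P S t)) ->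
        forall t1, t1 \in `[t0, tf] -> t0 <= t1 ->
          hamiltonian Q E x t1 - hamiltonian Q E x t0
            <= \int[lebesgue_measure]_(t in `[t0, t1]) dotp (y t) (u t)].
Proof.
move=> u x y cu [dx [xdx cdx] state] out.
have cx : C0_on `[t0, tf] x by exact: C0_on_deriv xdx.
have [dQ [QdQ _]] := hQ.
have cQ : C0_on `[t0, tf] Q by exact: C0_on_deriv QdQ.
set I := [set` `[t0, tf]] in cx cQ xdx *.
have balance t : t \in `[t0, tf] -> has_deriv_in I (hamiltonian Q E x) t
    (dotp (u t) (y t) - quad (Wmx Q R P S t) (col_mx (x t) (u t))).
  move=> tI.
  rewrite -(power_balance (hQE t tI) (hNskew t tI) (state t tI) (out t tI)).
  apply: has_deriv_inZ.
  (* [Q^T E] is treated as a single factor, so that its derivative is the one given by [hdQE]. *)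
  apply: (mx_deriv_mul (A := fun s => (x s)^T *m ((Q s)^T *m E s))).
    apply: mx_deriv_mul; first by apply/mx_deriv_tr/has_deriv_in_mx/xdx.
    exact/has_deriv_in_mx/hdQE.
  exact/has_deriv_in_mx/xdx.
split=> //.
  move=> W0 t tI; have := balance t tI.
  by rewrite W0// quadE mul0mx dotp0 subr0.
(* [FTC2_in] needs a nondegenerate interval; for [t1 = t0] both sides vanish. *)
move=> Wpsd t1 t1I; rewrite le_eqVlt => /predU1P[<-|t01].
  by rewrite subrr set_itv1 Rintegral_set1.
have sub : `[t0, t1] `<=` I.
  by apply: subset_itvl; rewrite bnd_simp; move: t1I; rewrite in_itv => /andP[].
have cuy : C0_on I (fun t => dotp (u t) (y t) : F^o).
  (* [y] is known only on [I], through the output equation, whose right side supplies its continuity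
     there. *)
  have cy : mx_C0 I y.
    apply: (@mx_C0_eq _ _ _ _ (fun t =>
        (B t + P t)^T *m Q t *m x t + (S t + N t) *m u t)).
      by move=> t; rewrite inE => tI; rewrite out.
    apply: mx_C0D.
      apply: mx_C0_mul; last exact: C0_on_mx.
      apply: mx_C0_mul; last exact: C0_on_mx.
      by apply/mx_C0_tr/mx_C0D; exact: C0_on_mx.
    by apply: mx_C0_mul; [apply: mx_C0D|]; exact: C0_on_mx.
  have cTuy := mx_C0_mul (mx_C0_tr (C0_on_mx cu)) cy.
  exact: (cTuy 0 0).
have cW : C0_on I (fun t => quad (Wmx Q R P S t) (col_mx (x t) (u t)) : F^o).
  have [cxm cum cQm] : [/\ mx_C0 I x, mx_C0 I u & mx_C0 I Q].
    by split; exact: C0_on_mx.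
  have [cPm cRm cSm] : [/\ mx_C0 I P, mx_C0 I R & mx_C0 I S].
    by split; exact: C0_on_mx.
  have cz := mx_C0_col cxm cum.
  have cWmx : mx_C0 I (Wmx Q R P S).
    (* [block_mx] unfolds to a column of two rows. *)
    apply: mx_C0_col; apply: mx_C0_row => //; repeat apply: mx_C0_mul => //;
      exact: mx_C0_tr.
  have czWz := mx_C0_mul (mx_C0_mul (mx_C0_tr cz) cWmx) cz.
  exact: (czWz 0 0).
pose g t : F^o := dotp (u t) (y t) - quad (Wmx Q R P S t) (col_mx (x t) (u t)).
have cg : C0_on I g by exact: within_continuousB cuy cW.
have -> : (fun t => dotp (y t) (u t)) = fun t => dotp (u t) (y t).
  by apply/funext => t; exact: dotpC.
(* The increment of the Hamiltonian becomes the integral of [g]; two continuous, hence integrable,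
   functions on [[t0, t1]] remain to be compared pointwise. *)
rewrite -(@FTC2_in _ t0 t1 _ g)//.
- apply: le_Rintegral => //.
  + apply: continuous_compact_integrable; first exact: segment_compact.
    exact: continuous_subspaceW cg.
  + apply: continuous_compact_integrable; first exact: segment_compact.
    exact: continuous_subspaceW cuy.
  + move=> t /sub tI; rewrite /g lerBlDr lerDl.
    by have [_] := Wpsd t tI; exact.
- exact: continuous_subspaceW cg.
- by move=> t /[dup] /sub tI tI1; apply: has_deriv_in_subset sub (balance t tI).
Qed.
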